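(* Given a probability distribution $P = p_1, \ldots, p_n$ and an integer $k \geq 2$, we can construct a probability distribution $Q = q_1, \ldots, q_n$ with $\max_{1 \leq i \leq n} \{p_i / q_i\} < 2 + \frac{1}{2^{k-3}}$, so $D(P \| Q) < \log\left(2 + \frac{1}{2^{k-3}}\right)$, and store $Q$ exactly in $kn - 2$ bits of space. Constructing, storing and recovering $Q$ each take $O(kn)$ time.
   Context: A probability distribution $P = p_1, \ldots, p_n$ is simply a (finite, ordered) sequence of non-negative real numbers that sum to $1$; the sample space is not stored. $\log$ means $\log_2$. The relative entropy of $P$ with respect to $Q$ is $D(P \| Q) = \sum_{i=1}^n p_i \log \frac{p_i}{q_i}$ (terms with $p_i = 0$ contribute $0$). ''Storing $Q$ exactly in $m$ bits'' means that $Q$ is encoded by a binary string of $m$ bits from which (with $n$ and $k$ known) the whole sequence $q_1, \ldots, q_n$ can be recovered exactly. Time is the number of elementary steps of the corresponding algorithm (constructing $Q$ from $P$ and $k$, producing the binary string, and recovering $Q$ from the string). *)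

(* Defs.v *)
From HB Require Import structures.
From mathcomp Require Import all_boot all_order all_algebra.
From mathcomp Require Import reals exp.

Set Implicit Arguments.
Unset Strict Implicit.
Unset Printing Implicit Defensive.

Import Order.TTheory GRing.Theory Num.Theory.

Local Open Scope ring_scope.

Definition is_distr (R : realType) (n : nat) (P : n.-tuple R) : Prop :=
  (forall i : 'I_n, 0 <= tnth P i) /\ \sum_(i < n) tnth P i = 1.

Definition log2 (R : realType) (x : R) : R := ln x / ln 2.

(* This is the usual divergence only when q_i = 0 implies p_i = 0: otherwise
   the divergence is infinite, whereas here p_i / 0 = 0. *)
Definition rel_entropy (R : realType) (n : nat) (P Q : n.-tuple R) : R :=
  \sum_(i < n) (if tnth P i == 0 then 0
                else tnth P i * log2 (tnth P i / tnth Q i)).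

Definition max_ratio (R : realType) (n : nat) (P Q : n.-tuple R) : R :=
  \big[Num.max/0]_(i < n) (tnth P i / tnth Q i).

(* Model of computation: a real RAM with unit-cost steps. It has integer and
   real registers and two random-access memories, one for integers and one for
   reals; integer registers serve as addresses. The reals support exact field
   operations and comparison, but there is no rounding and no other conversion
   from reals to integers. Integers are naturals and can only be added and
   subtracted, with truncation at 0. A program is a syntactic object that
   mentions finitely many registers and does not depend on R. *)

Inductive test :=
  | TLtI of nat & nat
  | TLtR of nat & nat.

(* The first operand is the destination register, except in StoreI a x and
   StoreR a x, which write register x at the address held by the integer
   register a. *)
Inductive cmd :=
  | Skip
  | ConstI of nat & nat
  | AddI of nat & nat & nat
  | SubI of nat & nat & nat
  | LoadI of nat & nat
  | StoreI of nat & nat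
  | ConstR of nat & nat
  | AddR of nat & nat & nat
  | SubR of nat & nat & nat
  | MulR of nat & nat & nat
  | DivR of nat & nat & nat
  | LoadR of nat & nat
  | StoreR of nat & nat
  | Seq of cmd & cmd
  | If of test & cmd & cmd
  | While of test & cmd.

Record state (R : Type) := State {
  ireg : nat -> nat;
  rreg : nat -> R;
  imem : nat -> nat;
  rmem : nat -> R }.

Definition upd (T : Type) (f : nat -> T) (a : nat) (v : T) : nat -> T :=
  fun b => if b == a then v else f b.

Section Semantics.
Variable R : realType.
Implicit Type s : state R.

Definition set_ireg s x v := State (upd (ireg s) x v) (rreg s) (imem s) (rmem s).
Definition set_rreg s x v := State (ireg s) (upd (rreg s) x v) (imem s) (rmem s).
Definition set_imem s a v := State (ireg s) (rreg s) (upd (imem s) a v) (rmem s).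
Definition set_rmem s a v := State (ireg s) (rreg s) (imem s) (upd (rmem s) a v).

Definition eval_test s (b : test) : bool :=
  match b with
  | TLtI x y => (ireg s x < ireg s y)%N
  | TLtR x y => rreg s x < rreg s y
  end.

(* exec c s t s' : started in s, the program c halts in s' after t steps.
   Division by zero blocks the machine. *)
Inductive exec : cmd -> state R -> nat -> state R -> Prop :=
  | ExSkip s : exec Skip s 1 s
  | ExConstI s x c : exec (ConstI x c) s 1 (set_ireg s x c)
  | ExAddI s x y z :
      exec (AddI x y z) s 1 (set_ireg s x (ireg s y + ireg s z)%N)
  | ExSubI s x y z :
      exec (SubI x y z) s 1 (set_ireg s x (ireg s y - ireg s z)%N)
  | ExLoadI s x a : exec (LoadI x a) s 1 (set_ireg s x (imem s (ireg s a)))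
  | ExStoreI s a x : exec (StoreI a x) s 1 (set_imem s (ireg s a) (ireg s x))
  | ExConstR s x c : exec (ConstR x c) s 1 (set_rreg s x c%:R)
  | ExAddR s x y z :
      exec (AddR x y z) s 1 (set_rreg s x (rreg s y + rreg s z))
  | ExSubR s x y z :
      exec (SubR x y z) s 1 (set_rreg s x (rreg s y - rreg s z))
  | ExMulR s x y z :
      exec (MulR x y z) s 1 (set_rreg s x (rreg s y * rreg s z))
  | ExDivR s x y z : rreg s z != 0 ->
      exec (DivR x y z) s 1 (set_rreg s x (rreg s y / rreg s z))
  | ExLoadR s x a : exec (LoadR x a) s 1 (set_rreg s x (rmem s (ireg s a)))
  | ExStoreR s a x : exec (StoreR a x) s 1 (set_rmem s (ireg s a) (rreg s x))
  | ExSeq c1 c2 s1 s2 s3 t1 t2 :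
      exec c1 s1 t1 s2 -> exec c2 s2 t2 s3 ->
      exec (Seq c1 c2) s1 (t1 + t2)%N s3
  | ExIf b c1 c2 s s' t :
      exec (if eval_test s b then c1 else c2) s t s' ->
      exec (If b c1 c2) s t.+1 s'
  | ExWhileF b c s : ~~ eval_test s b -> exec (While b c) s 1 s
  | ExWhileT b c s1 s2 s3 t1 t2 :
      eval_test s1 b -> exec c s1 t1 s2 -> exec (While b c) s2 t2 s3 ->
      exec (While b c) s1 (t1 + t2).+1 s3.

(* n and k are in the first two integer registers, the real data rs and the
   bits bs at the start of the two memories; everything else is 0. *)
Definition init (n k : nat) (rs : seq R) (bs : seq bool) : state R :=
  State (nth 0%N [:: n; k]) (fun=> 0)
        (fun a => nat_of_bool (nth false bs a)) (nth 0 rs).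

Definition outputs_reals (c : cmd) (s : state R) (T : nat) (out : seq R) : Prop :=
  exists (t : nat) (s' : state R),
    [/\ exec c s t s', (t <= T)%N &
        forall a, (a < size out)%N -> rmem s' a = nth 0 out a].

Definition outputs_bits (c : cmd) (s : state R) (T : nat) (out : seq bool) : Prop :=
  exists (t : nat) (s' : state R),
    [/\ exec c s t s', (t <= T)%N &
        forall a, (a < size out)%N -> imem s' a = nat_of_bool (nth false out a)].

End Semantics.

(* Main.v *)
(* Take M = kn - 1 and X = M - n, let c_i be X (p_1 + ... + p_i) rounded up, and
   put q_i = a_i / M with a_i = 1 + c_i - c_(i-1). The a_i are positive integers
   of sum X + n = M, so their unary codes, a_i - 1 zeros followed by a one, take
   M bits in all; the last of these is always a one and need not be stored. As
   a_i > p_i X, every ratio p_i / q_i is less than M / X, apart from the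
   degenerate case n = 1, k = 2, where X = 0. Each program spends a constant
   number of steps per bit and per symbol. *)
Require Import Defs.
From mathcomp Require Import all_boot all_order all_algebra.
From mathcomp Require Import reals exp.
From mathcomp Require Import zify ring lra.
Set Implicit Arguments.
Unset Strict Implicit.
Unset Printing Implicit Defensive.
Import Order.TTheory GRing.Theory Num.Theory.
Local Open Scope ring_scope.

(** * Time-bounded Hoare rules for the machine *)

Section Runs.
Variable R : realType.
Implicit Types (s : state R) (Q : state R -> Prop) (T : nat).

(** A total-correctness triple whose budget [T] is only an upper bound, so that costs compose
    without exact counts. *)
Definition runs c s T Q :=
  exists t s', [/\ exec c s t s', (t <= T)%N & Q s'].

Lemma runs_seq T1 T2 T c1 c2 s Q :
  (T1 + T2 <= T)%N -> runs c1 s T1 (fun s1 => runs c2 s1 T2 Q) ->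
  runs (Seq c1 c2) s T Q.
Proof.
move=> leT [t1 [s1 [e1 le1 [t2 [s2 [e2 le2 Qs2]]]]]].
exists (t1 + t2)%N, s2; split=> //; first exact: ExSeq e1 e2.
exact: leq_trans (leq_add le1 le2) leT.
Qed.

(** Indexing the invariant by the round fixes the number of rounds and lets the cost vary between
    them. The successor on each cost pays for a successful test, the outer one for the final failing
    test. *)
Lemma runs_while (I : nat -> state R -> Prop) (cost : nat -> nat) N T b c s Q :
  ((\sum_(i < N) (cost i).+1).+1 <= T)%N ->
  (forall i s, (i <= N)%N -> I i s -> eval_test s b = (i < N)%N) ->
  (forall i s, (i < N)%N -> I i s -> runs c s (cost i) (I i.+1)) ->
  I 0%N s -> (forall s, I N s -> Q s) ->
  runs (While b c) s T Q.
Proof.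
elim: N I cost T s => [|N IHN] I cost T s leT testI bodyI I0 IQ.
  exists 1%N, s; split; [|by rewrite big_ord0 in leT|exact: IQ].
  by apply: ExWhileF; rewrite (testI 0%N).
have [t1 [s1 [e1 le1 I1]]] := bodyI 0%N s isT I0.
have {IHN} [||||t2 [s2 [e2 le2 Qs2]]] :=
  IHN (fun i => I i.+1) (fun i => cost i.+1) _ s1 (leqnn _).
- by move=> i s' lei; apply: testI.
- by move=> i s' lei; apply: bodyI.
- exact: I1.
- exact: IQ.
exists (t1 + t2).+1, s2; split=> //.
  by apply: ExWhileT e1 e2; rewrite (testI 0%N).
apply: leq_trans leT; rewrite big_ord_recl /= !ltnS.
by rewrite addSn -addnS leq_add.
Qed.

(** Makes the final state of a straight-line block computable by simplification. *)
Fixpoint effect (c : cmd) s : state R :=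
  match c with
  | ConstI x c => set_ireg s x c
  | AddI x y z => set_ireg s x (ireg s y + ireg s z)%N
  | SubI x y z => set_ireg s x (ireg s y - ireg s z)%N
  | LoadI x a => set_ireg s x (imem s (ireg s a))
  | StoreI a x => set_imem s (ireg s a) (ireg s x)
  | ConstR x c => set_rreg s x c%:R
  | AddR x y z => set_rreg s x (rreg s y + rreg s z)
  | SubR x y z => set_rreg s x (rreg s y - rreg s z)
  | MulR x y z => set_rreg s x (rreg s y * rreg s z)
  | DivR x y z => set_rreg s x (rreg s y / rreg s z)
  | LoadR x a => set_rreg s x (rmem s (ireg s a))
  | StoreR a x => set_rmem s (ireg s a) (rreg s x)
  | Seq c1 c2 => effect c2 (effect c1 s)
  | _ => s
  end.

Fixpoint length (c : cmd) : nat :=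
  if c is Seq c1 c2 then (length c1 + length c2)%N else 1%N.

(* Loops and conditionals are rejected, so [effect] is only meaningful on
   straight-line code. *)
Fixpoint safe (c : cmd) s : bool :=
  match c with
  | DivR _ _ z => rreg s z != 0
  | Seq c1 c2 => safe c1 s && safe c2 (effect c1 s)
  | If _ _ _ | While _ _ => false
  | _ => true
  end.

Lemma exec_straight c s : safe c s -> exec c s (length c) (effect c s).
Proof.
elim: c s => //=; try by move=> *; constructor.
by move=> c1 IH1 c2 IH2 s /andP[/IH1 e1 /IH2 e2]; apply: ExSeq e1 e2.
Qed.

Lemma runs_straight c T s Q :
  (length c <= T)%N -> safe c s -> Q (effect c s) -> runs c s T Q.
Proof. by move=> ? /exec_straight ? ?; exists (length c), (effect c s). Qed.

End Runs.

(** * The programs *)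

Local Notation "c1 ;; c2" := (Seq c1 c2) (at level 60, right associativity).

(* Integer registers: 2 = symbol index, 3 = bit position, 4 = 1, 5 = kn - 2,
   6 = scratch. Real registers: 0 = 1/(kn - 1), 1 = kn - 1 - n, 2 = 1,
   5 = probability under construction, 6 = scaled cumulative probability,
   7 = its rounding, 8 = scratch. *)
Definition setup : cmd :=
  (ConstI 4 1 ;; ConstR 2 1) ;;
  While (TLtI 2 1) (AddI 2 2 4 ;; AddR 3 3 2) ;;
  ConstI 2 0 ;;
  While (TLtI 2 0) (AddI 2 2 4 ;; AddI 5 5 1 ;; AddR 1 1 3 ;; AddR 4 4 2) ;;
  ConstI 2 0 ;; ConstI 6 2 ;; SubI 5 5 6 ;;
  SubR 1 1 2 ;; DivR 0 2 1 ;; SubR 1 1 4.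

(** The machine cannot round, so the ceiling is reached by counting up in real register 7, which is
    never reset between symbols. Cell [i] is read before [q_i] overwrites [p_i] in it. *)
Definition construct : cmd :=
  setup ;;
  While (TLtI 2 0)
    ((LoadR 8 2 ;; MulR 8 8 1 ;; AddR 6 6 8 ;; ConstR 5 0 ;; AddR 5 5 0) ;;
     While (TLtR 7 6) (AddR 7 7 2 ;; AddR 5 5 0) ;;
     StoreR 2 5 ;; AddI 2 2 4).

(** The bit memory starts at 0, so a zero is written by merely advancing the position. *)
Definition store : cmd :=
  setup ;;
  While (TLtI 2 0)
    ((LoadR 8 2 ;; ConstR 5 0 ;; AddR 5 5 0) ;;
     While (TLtR 5 8) (AddR 5 5 0 ;; AddI 3 3 4) ;;
     StoreI 3 4 ;; AddI 3 3 4 ;; AddI 2 2 4).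

(* The final 1 of the code word is not stored, so [recover] writes it back. *)
Definition recover : cmd :=
  setup ;;
  StoreI 5 4 ;;
  While (TLtI 2 0)
    ((ConstR 5 0 ;; AddR 5 5 0 ;; LoadI 6 3) ;;
     While (TLtI 6 4) (AddR 5 5 0 ;; AddI 3 3 4 ;; LoadI 6 3) ;;
     StoreR 2 5 ;; AddI 3 3 4 ;; AddI 2 2 4).

(** * Correctness and running time of the programs *)

Section Programs.
Variables (R : realType) (n k : nat).
Hypotheses (n_gt0 : (0 < n)%N) (k_gt1 : (1 < k)%N).

Let M : R := (k * n - 1)%:R.
Let X : R := (k * n - 1 - n)%:R.

Definition constants (s : state R) : Prop :=
  [/\ ireg s 0 = n, ireg s 4 = 1%N, rreg s 0 = M^-1, rreg s 1 = X
    & rreg s 2 = 1].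

Lemma kn_gt1 : (1 < k * n)%N. Proof. by nia. Qed.
Lemma leq_n_kn : (n <= k * n - 1)%N. Proof. by nia. Qed.

Lemma M_gt0 : 0 < M. Proof. by rewrite ltr0n subn_gt0 kn_gt1. Qed.

(** The machine neither multiplies integers nor converts them to reals. The loops therefore count
    [k] and [n] up as reals and accumulate [kn] in both types by repeated addition. *)
Lemma runs_setup (rs : seq R) bs :
  runs setup (init n k rs bs) (12 + 3 * k + 5 * n)
    (fun s => [/\ constants s,
       [/\ ireg s 2 = 0, ireg s 3 = 0 & ireg s 5 = k * n - 2]%N,
       rreg s 6 = 0 /\ rreg s 7 = 0,
       imem s = (fun a => nat_of_bool (nth false bs a))
     & rmem s = nth 0 rs]).
Proof.
apply: (runs_seq (T1 := 2) (T2 := (10 + 3 * k + 5 * n)%N)); first by lia.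
apply: runs_straight => //=.
apply: (runs_seq (T1 := (1 + 3 * k)%N) (T2 := (9 + 5 * n)%N)); first by lia.
apply: (runs_while (I := fun i s =>
   [/\ [/\ ireg s 0 = n, ireg s 1 = k, ireg s 2 = i, ireg s 3 = 0
         & ireg s 4 = 1]%N,
       ireg s 5 = 0%N,
       [/\ rreg s 1 = 0, rreg s 2 = 1, rreg s 3 = i%:R & rreg s 4 = 0],
       rreg s 6 = 0 /\ rreg s 7 = 0
     & imem s = (fun a => nat_of_bool (nth false bs a)) /\ rmem s = nth 0 rs])
   (cost := fun=> 2%N) (N := k)).
- by rewrite sum_nat_const card_ord mulnC.
- by move=> i s _ [[_ i1 i2 _ _] _ _ _ _] /=; rewrite i1 i2.
- move=> i s _ [[i0 i1 i2 i3 i4] i5 [r1 r2 r3 r4] [r6 r7] mem].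
  apply: runs_straight => //=; split=> //=; split=> //.
    by rewrite /upd /= i2 i4 addn1.
  by rewrite /upd /= r3 r2 -natr1.
- by split.
move=> s [[i0 i1 i2 i3 i4] i5 [r1 r2 r3 r4] [r6 r7] mem].
apply: (runs_seq (T1 := 1) (T2 := (8 + 5 * n)%N)); first by lia.
apply: runs_straight => //=.
apply: (runs_seq (T1 := (1 + 5 * n)%N) (T2 := 6)); first by lia.
apply: (runs_while (I := fun i s =>
   [/\ [/\ ireg s 0 = n, ireg s 1 = k, ireg s 2 = i, ireg s 3 = 0
         & ireg s 4 = 1]%N,
       ireg s 5 = (i * k)%N,
       [/\ rreg s 1 = (i * k)%:R, rreg s 2 = 1, rreg s 3 = k%:R
         & rreg s 4 = i%:R],
       rreg s 6 = 0 /\ rreg s 7 = 0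
     & imem s = (fun a => nat_of_bool (nth false bs a)) /\ rmem s = nth 0 rs])
   (cost := fun=> 4%N) (N := n)).
- by rewrite sum_nat_const card_ord mulnC.
- by move=> i s' _ [[i0' _ i2' _ _] _ _ _ _] /=; rewrite i0' i2'.
- move=> i s' _ [[i0' i1' i2' i3' i4'] i5' [r1' r2' r3' r4'] r67 mem'].
  apply: runs_straight => //=; split=> //=; rewrite /upd /=.
  + by split=> //; rewrite i2' i4' addn1.
  + by rewrite i5' i1' mulSn addnC.
  + by split=> //; rewrite ?r1' ?r3' ?r4' ?r2' ?natr1 // mulSn natrD addrC.
- by split=> //=.
move=> s' [[i0' i1' i2' i3' i4'] i5' [r1' r2' r3' r4'] [r6' r7'] [im rm]].
have M1 : (n * k)%:R - 1 = M by rewrite /M mulnC natrB // ltnW ?kn_gt1.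
apply: runs_straight => //=; rewrite /upd /=.
  by rewrite r1' r2' M1 gt_eqF ?M_gt0.
split=> //=; last by rewrite /upd /= i5' mulnC.
split=> //=; rewrite /upd /= r1' r2' M1 ?mul1r // r4' /X natrB ?leq_n_kn //.
Qed.

(** * Layout of the unary code words *)

Variable d : nat -> nat.
Hypothesis sum_d : (\sum_(i < n) (d i).+1 = k * n - 1)%N.

(** Position of the first bit of code word [i], which consists of [d i] zeros and a one. *)
Definition start (i : nat) : nat := \sum_(l < i) (d l).+1.

Lemma startS i : start i.+1 = (start i + (d i).+1)%N.
Proof. by rewrite /start big_ord_recr. Qed.

Lemma leq_start i j : (i <= j)%N -> (start i <= start j)%N.
Proof.
move=> /subnK <-; elim: (j - i)%N => // m IHm.
by rewrite addSn startS (leq_trans IHm) ?leq_addr.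
Qed.

(** Places the final ones of the first [i] code words only: this is the bit memory of [store] after
    [i] rounds. *)
Definition mark (i a : nat) : bool :=
  has (fun l => a.+1 == start l.+1) (iota 0 i).

Lemma markS i a : mark i.+1 a = (a == start i + d i)%N || mark i a.
Proof.
by rewrite /mark -[in iota _ _]addn1 iotaD has_cat /= orbF orbC startS addnS eqSS.
Qed.

(** Code words occupy disjoint intervals, as [start] is monotone. Scanning from [start i] to the
    next one therefore decodes [d i]. *)
Lemma mark_in i m : (i < n)%N -> (m <= d i)%N ->
  mark n (start i + m) = (m == d i).
Proof.
move=> lt_in le_md; apply/hasP/eqP => [[l _]|->]; last first.
  by exists i; rewrite ?mem_iota ?startS ?addnS.
have [lt_li|lt_il|<-] := ltngtP l i.
- by have := leq_start lt_li; lia.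
- by have := leq_start lt_il; rewrite (startS i) (startS l); lia.
- by rewrite startS; lia.
Qed.

(** The lengths add up to [k * n - 1], so the last code word ends at [k * n - 2] whatever [d] is,
    and dropping that bit loses nothing. *)
Lemma mark_last a :
  mark n a = (a == k * n - 2)%N || (mark n a && (a < k * n - 2)%N).
Proof.
have := kn_gt1 => kn.
apply/idP/orP => [mk|[/eqP ->|/andP[]//]].
  case/hasP: (mk) => l; rewrite mem_iota /= add0n => lt_ln /eqP e.
  have := leq_start lt_ln; rewrite -e [start n]sum_d => ?.
  by rewrite mk /=; lia.
have -> : (k * n - 2 = start n.-1 + d n.-1)%N.
  by have := startS n.-1; rewrite prednK // [start n]sum_d; lia.
by rewrite mark_in ?prednK.
Qed.

Definition quant : n.-tuple R := [tuple (d i).+1%:R / M | i < n].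
Definition code : (k * n - 2).-tuple bool := [tuple mark n i | i < k * n - 2].

Lemma nth_quant i : (i < n)%N -> nth 0 quant i = (d i).+1%:R / M.
Proof.
by move=> lt_in; rewrite -[i]/(val (Ordinal lt_in)) -tnth_nth tnth_mktuple.
Qed.

Lemma nth_code a : nth false code a = mark n a && (a < k * n - 2)%N.
Proof.
have [lt_a|ge_a] := ltnP a; last by rewrite nth_default ?size_tuple ?andbF.
by rewrite andbT -[a]/(val (Ordinal lt_a)) -tnth_nth tnth_mktuple.
Qed.

(** Amortisation: a single inner loop may be long, but the [(d i).+1] sum to [k * n - 1]. *)
Lemma cost_bound (A : nat) :
  (\sum_(i < n) (A + 4 * d i).+1 <= A * n + 4 * (k * n))%N.
Proof.
rewrite (@leq_trans (\sum_(i < n) (A + 4 * (d i).+1)))%N ?leq_sum //.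
  by move=> i _; lia.
by rewrite big_split -big_distrr /= sum_d sum_nat_const card_ord; lia.
Qed.

Lemma total_bound : (100 + 3 * k + 25 * n + 4 * (k * n) <= 200 * (k * n))%N.
Proof.
have : (k <= k * n)%N by nia.
by have := kn_gt1; have := leq_n_kn; lia.
Qed.


Lemma runs_main body s Q (I : nat -> state R -> Prop) :
  (forall i s, I i s -> ireg s 2 = i /\ ireg s 0 = n) ->
  (forall i s, (i < n)%N -> I i s -> runs body s (10 + 4 * d i) (I i.+1)) ->
  I 0%N s -> (forall s, I n s -> Q s) ->
  runs (While (TLtI 2 0) body) s (1 + 10 * n + 4 * (k * n)) Q.
Proof.
move=> regI bodyI I0 IQ.
apply: (runs_while (I := I) (cost := fun i => (10 + 4 * d i)%N) (N := n)) => //.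
  by have := cost_bound 10; lia.
by move=> i s' _ /regI[/= -> ->].
Qed.

Lemma store_outputs :
  outputs_bits store (init n k quant [::]) (200 * (k * n)) code.
Proof.
(* The last one is written at address [k * n - 2], just past the output, so the claim is about
   [mark n] instead of [code]. *)
suff [t [s [e le_t im]]] : runs store (init n k quant [::]) (200 * (k * n))
    (fun s => forall a, imem s a = mark n a).
  exists t, s; split=> // a; rewrite size_tuple => lt_a.
  by rewrite im nth_code lt_a andbT.
have bound := total_bound; have := runs_setup quant [::].
move=> [t1 [s1 [e1 le1 [c1 [i2 i3 _] _ im1 rm1]]]].
apply: (runs_seq (T1 := (12 + 3 * k + 5 * n)%N) (T2 := (1 + 10 * n + 4 * (k * n))%N)).
  by lia.
exists t1, s1; split=> // {t1 e1 le1}.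
apply: (runs_main (I := fun i s => [/\ constants s, ireg s 2 = i,
   ireg s 3 = start i, (forall a, imem s a = mark i a) & rmem s = nth 0 quant])).
- by move=> i s [[]].
- move=> i s lt_in [cst j2 j3 im rm].
  apply: (runs_seq (T1 := 3) (T2 := (7 + 4 * d i)%N)); first by lia.
  have [j0 j4 r0 r1 r2] := cst.
  apply: runs_straight => //=.
  apply: (runs_seq (T1 := (1 + 3 * d i)%N) (T2 := 3)); first by lia.
  apply: (runs_while (I := fun m s => [/\ constants s, ireg s 2 = i,
     ireg s 3 = (start i + m)%N,
     rreg s 5 = m.+1%:R / M /\ rreg s 8 = (d i).+1%:R / M
   & (forall a, imem s a = mark i a) /\ rmem s = nth 0 quant])
   (cost := fun=> 2%N) (N := d i)).
  + by rewrite sum_nat_const card_ord mulnC.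
  + move=> m s' _ [_ _ _ [/= -> ->] _].
    by rewrite ltr_pM2r ?invr_gt0 ?M_gt0 // ltr_nat ltnS.
  + move=> m s' _ [[j0' j4' r0' r1' r2'] j2' j3' [r5' r8'] mem].
    apply: runs_straight => //=; split=> //=; rewrite /upd /=.
      by rewrite j3' j4' addn1 addnS.
    by rewrite r5' r0' -[m.+2%:R]natr1 mulrDl mul1r.
  + split=> //=; rewrite /upd /= ?addn0 //.
    by rewrite j2 rm nth_quant // add0r r0 mul1r.
  move=> s' [[j0' j4' r0' r1' r2'] j2' j3' [r5' r8'] [im' rm']].
  apply: runs_straight => //=; split=> //=; rewrite /upd /=.
  + by rewrite j2' j4' addn1.
  + by rewrite j3' j4' startS addn1 addnS.
  + by move=> a; rewrite j3' markS im' j4'; case: eqP.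
- by split=> //; [rewrite i3 /start big_ord0 | move=> a; rewrite im1 nth_nil].
- by move=> s [].
Qed.

Lemma recover_outputs :
  outputs_reals recover (init n k [::] code) (200 * (k * n)) quant.
Proof.
suff [t [s [e le_t rm]]] : runs recover (init n k [::] code) (200 * (k * n))
    (fun s => forall a, (a < n)%N -> rmem s a = nth 0 quant a).
  by exists t, s; split=> // a; rewrite size_tuple; apply: rm.
have bound := total_bound; have := runs_setup [::] code.
move=> [t1 [s1 [e1 le1 [c1 [i2 i3 i5] _ im1 rm1]]]].
apply: (runs_seq (T1 := (12 + 3 * k + 5 * n)%N) (T2 := (2 + 10 * n + 4 * (k * n))%N)).
  by lia.
exists t1, s1; split=> // {t1 e1 le1}.
apply: (runs_seq (T1 := 1) (T2 := (1 + 10 * n + 4 * (k * n))%N)); first by lia.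
apply: runs_straight => //=.
apply: (runs_main (I := fun i s => [/\ constants s, ireg s 2 = i,
   ireg s 3 = start i, (forall a, imem s a = mark n a)
   & (forall a, (a < i)%N -> rmem s a = nth 0 quant a)])).
- by move=> i s [[]].
- move=> i s lt_in [cst j2 j3 im rm].
  apply: (runs_seq (T1 := 3) (T2 := (7 + 4 * d i)%N)); first by lia.
  have [j0 j4 r0 r1 r2] := cst.
  apply: runs_straight => //=.
  apply: (runs_seq (T1 := (1 + 4 * d i)%N) (T2 := 3)); first by lia.
  apply: (runs_while (I := fun m s => [/\ constants s, ireg s 2 = i,
     ireg s 3 = (start i + m)%N /\ ireg s 6 = mark n (start i + m),
     rreg s 5 = m.+1%:R / M
   & (forall a, imem s a = mark n a) /\
     (forall a, (a < i)%N -> rmem s a = nth 0 quant a)])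
   (cost := fun=> 3%N) (N := d i)).
  + by rewrite sum_nat_const card_ord mulnC.
  (* Register 6 holds the bit just read, so the loop goes on while it reads zeros. *)
  + move=> m s' le_md [[_ /= -> _ _ _] _ [_ ->] _ _].
    by rewrite mark_in //; case: (ltngtP m (d i)) le_md.
  + move=> m s' _ [[j0' j4' r0' r1' r2'] j2' [j3' j6'] r5' [im' rm']].
    apply: runs_straight => //=; split=> //=; rewrite /upd /=.
      by rewrite im' j3' j4' addn1 addnS.
    by rewrite r5' r0' -[m.+2%:R]natr1 mulrDl mul1r.
  + split=> //=; rewrite /upd /= ?addn0 ?im ?j3 //.
    by rewrite add0r r0 mul1r.
  move=> s' [[j0' j4' r0' r1' r2'] j2' [j3' j6'] r5' [im' rm']].
  apply: runs_straight => //=; split=> //=; rewrite /upd /=.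
  + by rewrite j2' j4' addn1.
  + by rewrite j3' j4' startS addn1 addnS.
  + move=> a; rewrite j2' ltnS leq_eqVlt; case: eqP => [-> _|_ /rm' //].
    by rewrite r5' nth_quant.
- have [j0 j4 r0 r1 r2] := c1; split=> //=; first by rewrite i3 /start big_ord0.
  (* The one written back at [k * n - 2] completes [code] to [mark n]. *)
  by move=> a; rewrite /upd i5 j4 mark_last im1 nth_code; case: eqP.
- by move=> s [].
Qed.

Variable P : n.-tuple R.
Variable c : nat -> nat.
Hypothesis c0 : c 0 = 0%N.
Hypothesis d_c : forall i, c i.+1 = (c i + d i)%N.
Hypothesis lt_c : forall i m, (m%:R < \sum_(l < i) nth 0 P l * X) = (m < c i)%N.

(** [lt_c] describes a ceiling by its comparison with naturals, which is exactly the test of the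
    inner loop: from [c i] it reaches [c i.+1] after [d i] rounds. *)
Lemma construct_outputs :
  outputs_reals construct (init n k P [::]) (200 * (k * n)) quant.
Proof.
suff [t [s [e le_t rm]]] : runs construct (init n k P [::]) (200 * (k * n))
    (fun s => forall a, (a < n)%N -> rmem s a = nth 0 quant a).
  by exists t, s; split=> // a; rewrite size_tuple; apply: rm.
have bound := total_bound; have := runs_setup P [::].
move=> [t1 [s1 [e1 le1 [c1 [i2 i3 _] [r6 r7] im1 rm1]]]].
apply: (runs_seq (T1 := (12 + 3 * k + 5 * n)%N) (T2 := (1 + 10 * n + 4 * (k * n))%N)).
  by lia.
exists t1, s1; split=> // {t1 e1 le1}.
apply: (runs_main (I := fun i s => [/\ constants s, ireg s 2 = i,
   rreg s 6 = \sum_(l < i) nth 0 P l * X /\ rreg s 7 = (c i)%:R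
   & (forall a, rmem s a = if (a < i)%N then nth 0 quant a else nth 0 P a)])).
- by move=> i s [[]].
- move=> i s lt_in [cst j2 [s6 s7] rm].
  apply: (runs_seq (T1 := 5) (T2 := (5 + 4 * d i)%N)); first by lia.
  have [j0 j4 r0 r1 r2] := cst.
  apply: runs_straight => //=.
  apply: (runs_seq (T1 := (1 + 3 * d i)%N) (T2 := 2)); first by lia.
  apply: (runs_while (I := fun m s => [/\ constants s, ireg s 2 = i,
     rreg s 6 = \sum_(l < i.+1) nth 0 P l * X /\ rreg s 7 = (c i + m)%:R,
     rreg s 5 = m.+1%:R / M
   & (forall a, rmem s a = if (a < i)%N then nth 0 quant a else nth 0 P a)])
   (cost := fun=> 2%N) (N := d i)).
  + by rewrite sum_nat_const card_ord mulnC.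
  + by move=> m s' _ [_ _ [/= -> ->] _ _]; rewrite lt_c d_c ltn_add2l.
  + move=> m s' _ [[j0' j4' r0' r1' r2'] j2' [s6' s7'] r5' rm'].
    apply: runs_straight => //=; split=> //=; rewrite /upd /=.
      by rewrite s6' s7' r2' addnS natr1.
    by rewrite r5' r0' -[m.+2%:R]natr1 mulrDl mul1r.
  + split=> //=; rewrite /upd /= ?addn0 ?add0r ?r0 ?mul1r //.
    by rewrite big_ord_recr /= s6 s7 r1 j2 rm ltnn.
  move=> s' [[j0' j4' r0' r1' r2'] j2' [s6' s7'] r5' rm'].
  apply: runs_straight => //=; split=> //=; rewrite /upd /=.
  + by rewrite j2' j4' addn1.
  + by rewrite s6' s7' d_c.
  + move=> a; rewrite j2' rm' ltnS; case: ltngtP => // ->.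
    by rewrite r5' -nth_quant // leqnn.
- by split=> //; [rewrite r6 r7 big_ord0 c0 | move=> a; rewrite rm1].
- by move=> s [_ _ _ rm] a lt_a; rewrite rm lt_a.
Qed.
End Programs.

(** * Rounding, and the ratio and entropy bounds *)

Section Rounding.
Variable R : realType.

Definition ceiln (x : R) : nat := `|Num.ceil x|%N.

(** The adjunction between ceiling and the embedding of naturals, from which the facts on [ceiln]
    below follow. *)
Lemma ltn_ceiln x m : 0 <= x -> (m < ceiln x)%N = (m%:R < x).
Proof.
move=> x0; have c0 : 0 <= Num.ceil x.
  by rewrite ceil_ge0; apply: lt_le_trans x0; rewrite ltrN10.
by rewrite -ltz_nat gez0_abs // ceil_gt_int.
Qed.

Lemma ceiln_ge x : 0 <= x -> x <= (ceiln x)%:R.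
Proof. by move=> x0; rewrite leNgt -ltn_ceiln // ltnn. Qed.

Lemma ceiln_lt x : 0 <= x -> (ceiln x)%:R < x + 1.
Proof.
move=> x0; have [->|] := posnP (ceiln x); first by rewrite ltr_wpDl.
by move=> c0; rewrite -(prednK c0) -natr1 ltrD2r -ltn_ceiln // prednK.
Qed.

Lemma leq_ceiln x y : 0 <= x <= y -> (ceiln x <= ceiln y)%N.
Proof.
move=> /andP[x0 le_xy]; rewrite leqNgt ltn_ceiln // -leNgt.
by rewrite (le_trans le_xy) // ceiln_ge // (le_trans x0).
Qed.

Lemma ceiln_nat m : ceiln m%:R = m.
Proof.
apply/eqP; rewrite eqn_leq -(ler_nat R m) ceiln_ge // andbT.
by rewrite leqNgt ltn_ceiln // ltxx.
Qed.

(** Termwise comparison with the sum of [p_i log B], which is [log B]. Strictness needs one positive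
    [p_i], which exists since the [p_i] sum to 1. *)
Lemma rel_entropy_lt n (P Q : n.-tuple R) B : is_distr P ->
  (forall i, 0 < tnth Q i) -> (forall i, tnth P i / tnth Q i < B) ->
  rel_entropy P Q < log2 B.
Proof.
move=> [P0 P1] Q0 ltB.
have ln2 : 0 < ln (2 : R) by rewrite ln_gt0 // ltr1n.
have lt_log i : 0 < tnth P i ->
    tnth P i * log2 (tnth P i / tnth Q i) < tnth P i * log2 B.
  move=> Pi; have r0 : 0 < tnth P i / tnth Q i by rewrite divr_gt0.
  rewrite ltr_pM2l // ltr_pM2r ?invr_gt0 // ltr_ln // posrE //.
  exact: lt_trans (ltB i).
have [i0 Pi0] : exists i, 0 < tnth P i.
  apply/existsP; apply: contraPT P1 => /existsPn P_le0.
  rewrite big1 => [|i _]; first by apply/eqP; rewrite eq_sym oner_eq0.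
  by apply/eqP; rewrite eq_le P0 andbT leNgt P_le0.
rewrite -[ltRHS]mul1r -P1 mulr_suml /rel_entropy.
rewrite (bigD1 i0) //= [ltRHS](bigD1 i0) //=.
rewrite gt_eqF // ltr_leD ?lt_log // ler_sum // => i _.
case: eqP => [->|/eqP Pi]; first by rewrite mul0r.
by rewrite ltW // lt_log // lt_def Pi P0.
Qed.

(** * Differences of rounded cumulative sums *)

Section Gaps.
Variables (n k : nat) (P : n.-tuple R).
Hypotheses (n_gt0 : (0 < n)%N) (k_gt1 : (1 < k)%N) (distrP : is_distr P).

Let X : R := (k * n - 1 - n)%:R.

(** Total in [i]: entries past [n] default to 0, so the sums stay constant there. *)
Definition cumul (i : nat) : R := \sum_(l < i) nth 0 P l * X.

(** The number of zeros in the code word. The subtraction never truncates, as [cumul] is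
    nondecreasing. *)
Definition gap (i : nat) : nat := (ceiln (cumul i.+1) - ceiln (cumul i))%N.

Lemma cumul_ge0 i : 0 <= cumul i.
Proof.
apply: sumr_ge0 => l _; apply: mulr_ge0; last exact: ler0n.
have [lt_ln|ge_ln] := ltnP l n; last by rewrite nth_default ?size_tuple.
by rewrite -[val l]/(val (Ordinal lt_ln)) -tnth_nth; case: distrP.
Qed.

Lemma cumulS i : cumul i.+1 = cumul i + nth 0 P i * X.
Proof. by rewrite /cumul big_ord_recr. Qed.

Lemma ceiln_cumulS i : ceiln (cumul i.+1) = (ceiln (cumul i) + gap i)%N.
Proof.
rewrite subnKC // leq_ceiln // cumul_ge0 /= cumulS lerDl.
rewrite mulr_ge0 ?ler0n //; have [lt_in|ge_in] := ltnP i n.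
  by rewrite -[i]/(val (Ordinal lt_in)) -tnth_nth; case: distrP.
by rewrite nth_default ?size_tuple.
Qed.

Lemma cumul_n : cumul n = X.
Proof.
rewrite /cumul -mulr_suml -[RHS]mul1r; congr (_ * _).
by case: distrP => _ <-; apply: eq_bigr => i _; rewrite (tnth_nth 0).
Qed.

(** The ceilings telescope to that of [X], which is exact because [X] is a natural number. *)
Lemma sum_gap : (\sum_(i < n) (gap i).+1 = k * n - 1)%N.
Proof.
have partial m : (\sum_(i < m) (gap i).+1 = ceiln (cumul m) + m)%N.
  elim: m => [|m IHm]; first by rewrite big_ord0 /cumul big_ord0 (ceiln_nat 0).
  by rewrite big_ord_recr /= IHm ceiln_cumulS; lia.
(* The subtractions in [X] do not truncate, since [k >= 2] and [n > 0]. *)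
by rewrite partial cumul_n ceiln_nat; nia.
Qed.

(** Rounding up raises [cumul i] by less than 1 and does not lower [cumul i.+1], so their difference
    drops by less than 1. *)
Lemma gap_gt i : nth 0 P i * X < (gap i).+1%:R.
Proof.
have := ceiln_ge (cumul_ge0 i.+1); rewrite ceiln_cumulS natrD cumulS.
by have := ceiln_lt (cumul_ge0 i); rewrite -natr1; lra.
Qed.

Lemma bound_gt2 : 2 < 2 + 1 / 2 ^ (k%:Z - 3) :> R.
Proof. by rewrite ltrDl divr_gt0 // exprz_gt0. Qed.

(* [gap_gt] gives [p_i X < gap i + 1], and [kn - 1 <= 2X] as soon as [k >= 3],
   while [kn - 1 <= 3X] for [k = 2] unless [n = 1]. *)
Lemma ratio_lt (i : 'I_n) :
  tnth P i / ((gap i).+1%:R / (k * n - 1)%:R) < 2 + 1 / 2 ^ (k%:Z - 3).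
Proof.
have M0 : 0 < (k * n - 1)%:R :> R by rewrite ltr0n; nia.
rewrite invf_div mulrA ltr_pdivrMr ?ltr0Sn //.
have := gap_gt i; rewrite -tnth_nth; set p := tnth P i; set g := _.+1%:R => lt_g.
have p0 : 0 <= p by case: distrP => P0 _; apply: P0.
have p1 : p <= 1.
  case: distrP => P0 <-; rewrite (bigD1 i) //= lerDl.
  by apply: sumr_ge0 => j _.
have g1 : 1 <= g by rewrite ler1n.
have [k2|k3] : k = 2 \/ (2 < k)%N by lia.
  have -> : 2 + 1 / 2 ^ (k%:Z - 3) = 4 :> R.
    by rewrite k2 (_ : 2%:Z - 3 = -1) // exprN1 div1r invrK; lra.
  have [n1|n2] : n = 1%N \/ (1 < n)%N by lia.
    (* Here [X = 0], so [gap_gt] says too little; [p <= 1 <= g] suffices because [k * n - 1 = 1]. *)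
    by rewrite n1 k2 (_ : (2 * 1 - 1)%N = 1%N) // mulr1; lra.
  have : (k * n - 1 <= 3 * (k * n - 1 - n))%N by nia.
  by rewrite -(ler_nat R) natrM -/X => le_M; nra.
have := bound_gt2; set B := 2 + _ => B2.
(* This gives [p (k n - 1) <= 2 p X < 2 g < B g]. *)
have : (k * n - 1 <= 2 * (k * n - 1 - n))%N by nia.
by rewrite -(ler_nat R) natrM -/X => le_M; nra.
Qed.

End Gaps.
End Rounding.

Theorem theorem3 (R : realType) :
  exists (construct store recover : cmd) (C : nat),
  forall (n k : nat) (P : n.-tuple R), (2 <= k)%N -> is_distr P ->
  exists (Q : n.-tuple R) (b : (k * n - 2).-tuple bool),
    is_distr Q /\
    (forall i : 'I_n, 0 < tnth Q i) /\
    max_ratio P Q < 2 + 1 / 2 ^ (k%:Z - 3) /\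
    rel_entropy P Q < log2 (2 + 1 / 2 ^ (k%:Z - 3)) /\
    outputs_reals construct (init n k P [::]) (C * (k * n)) Q /\
    outputs_bits store (init n k Q [::]) (C * (k * n)) b /\
    outputs_reals recover (init n k [::] b) (C * (k * n)) Q.
Proof.
(* The constant 200 is that of [total_bound]. *)
exists construct, store, recover, 200%N => n k P k_gt1 distrP.
(* An empty sequence sums to 0 and is not a distribution. *)
have n_gt0 : (0 < n)%N.
  case: n P distrP => // P [_]; rewrite big_ord0 => /eqP.
  by rewrite eq_sym oner_eq0.
have sum_d := sum_gap n_gt0 k_gt1 distrP.
set d := gap k P in sum_d.
have M0 := M_gt0 R n_gt0 k_gt1.
exists (quant R n k d), (code n k d).
have Q0 i : 0 < tnth (quant R n k d) i.
  by rewrite tnth_mktuple divr_gt0 // ltr0Sn.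
have ratioB i : tnth P i / tnth (quant R n k d) i < 2 + 1 / 2 ^ (k%:Z - 3).
  by rewrite tnth_mktuple ratio_lt.
split; [split=> [i|]|split=> //; split; [|split; [|split; [|split]]]].
- exact: ltW.
- under eq_bigr do rewrite tnth_mktuple.
  by rewrite -mulr_suml -natr_sum sum_d divff // gt_eqF.
(* The maximum has base value 0, so the bound must also be shown positive. *)
- apply: bigmax_lt => [|i _]; last exact: ratioB.
  by rewrite (lt_trans _ (bound_gt2 R k)) // ltr0n.
- exact: rel_entropy_lt.
- apply: (@construct_outputs R n k n_gt0 k_gt1 d sum_d P
            (fun i => ceiln (cumul k P i))) => //.
  + by rewrite /cumul big_ord0; exact: (ceiln_nat R 0).
  + exact: ceiln_cumulS.
  + by move=> i m; rewrite ltn_ceiln // cumul_ge0.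
- exact: store_outputs.
- exact: recover_outputs.
Qed.
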